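(* For every bipartite graph $H$ on $n$ vertices with maximum degree $\Delta$, $r(H)\le 2^{\Delta+6}n$.
   Context: The Ramsey number $r(H)$ is the least positive integer $N$ such that every two-coloring of the edges of the complete graph $K_N$ contains a monochromatic copy of $H$. *)

(* Defs.v *)
From mathcomp Require Import all_boot.

Set Implicit Arguments.
Unset Strict Implicit.
Unset Printing Implicit Defensive.

Record sgraph := SGraph {
  svertex :> finType;
  sedge : rel svertex;
  sedge_sym : symmetric sedge;
  sedge_irr : irreflexive sedge
}.

Definition degree (G : sgraph) (x : G) : nat := #|[set y | sedge x y]|.

Definition max_degree (G : sgraph) : nat := \max_(x : G) degree x.

Definition bipartite (G : sgraph) : Prop :=
  exists A : {set G},
    forall x y : G, sedge x y -> (x \in A) != (y \in A).

(* Edges of K_N are the two-element subsets of 'I_N; a colouring assigns a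
   value to every subset, but only its values on two-element subsets are ever
   inspected. *)
Definition edge_coloring (N : nat) : finType := {ffun {set 'I_N} -> bool}.

(* [f] embeds [H] as a (not necessarily induced) subgraph of K_N all of whose
   edges have colour [b]; by injectivity of [f] and irreflexivity of [sedge],
   [set f x; f y] is indeed an edge of K_N. *)
Definition mono_copy (H : sgraph) N (c : edge_coloring N)
    (b : bool) (f : {ffun H -> 'I_N}) : bool :=
  injectiveb f &&
  [forall x, forall y, sedge x y ==> (c [set f x; f y] == b)].

Definition arrows (N : nat) (H : sgraph) : bool :=
  [forall c : edge_coloring N,
     [exists b : bool, [exists f : {ffun H -> 'I_N}, mono_copy c b f]]].

Lemma ramsey_cliques (k l : nat) : exists R : nat,
  forall N (c : edge_coloring N) (S : {set 'I_N}), R <= #|S| ->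
  exists b : bool, exists A : {set 'I_N},
    [/\ #|A| = (if b then k else l),
        A \subset S
      & {in A &, forall x y, x != y -> c [set x; y] = b}].
Proof.
have [m] := ubnP (k + l); elim: m k l => // m IHm [|k] l.
  move=> _; exists 0 => N c S _; exists true, set0.
  by split; rewrite ?cards0 ?sub0set // => x y; rewrite inE.
case: l => [|l] le_m.
  exists 0 => N c S _; exists false, set0.
  by split; rewrite ?cards0 ?sub0set // => x y; rewrite inE.
have [|R1 HR1] := IHm k l.+1; first by rewrite -ltnS.
have [|R2 HR2] := IHm k.+1 l; first by move: le_m; rewrite ltnS addnS.
exists (R1 + R2).+1 => N c S leS.
have [v vS] : exists v, v \in S by apply/set0Pn; rewrite -card_gt0 (leq_trans _ leS).
pose T b := [set x in S :\ v | c [set v; x] == b].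
have TS b : T b \subset S by apply/subsetP=> x; rewrite !inE => /andP[/andP[]].
have vT b : v \notin T b by rewrite !inE eqxx.
have ext b (A : {set 'I_N}) : A \subset T b ->
    {in A &, forall x y, x != y -> c [set x; y] = b} ->
  [/\ #|v |: A| = #|A|.+1, v |: A \subset S &
     {in v |: A &, forall x y, x != y -> c [set x; y] = b}].
  move=> AT cA; have cv x : x \in A -> c [set v; x] = b.
    by move/(subsetP AT); rewrite inE => /andP[_ /eqP].
  split.
  - by rewrite cardsU1 (contra (subsetP AT v)).
  - by rewrite subUset sub1set vS (subset_trans AT).
  move=> x y /setU1P[->|xA] /setU1P[->|yA]; rewrite ?eqxx // => nxy.
  - exact: cv.
  - by rewrite setUC cv.
  - exact: cA.
have cardT : R1 + R2 <= #|T true| + #|T false|.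
  rewrite -ltnS; apply: leq_trans leS _.
  rewrite (cardsD1 v S) vS add1n ltnS -(cardsID (T true) (S :\ v)).
  apply: leq_add; first exact/subset_leq_card/subsetIr.
  apply/subset_leq_card/subsetP=> x; rewrite !inE => /andP[nx /andP[xv xS]].
  by move: nx; rewrite xv xS /=; case: (c _).
have [le1|lt1] := leqP R1 #|T true|.
  have [[] [A [cA sA mA]]] := HR1 N c _ le1.
    by have [e1 e2 e3] := ext _ _ sA mA; exists true, (v |: A); rewrite e1 cA.
  by exists false, A; split=> //; apply: subset_trans sA (TS _).
have le2 : R2 <= #|T false|.
  rewrite leqNgt; apply/negP => lt2; move: cardT.
  by rewrite leqNgt -addnS leq_add // ltnW.
have [[] [A [cA sA mA]]] := HR2 N c _ le2.
  by exists true, A; split=> //; apply: subset_trans sA (TS _).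
by have [e1 e2 e3] := ext _ _ sA mA; exists false, (v |: A); rewrite e1 cA.
Qed.

Lemma ramsey_exists (H : sgraph) : exists N, (0 < N) && arrows N H.
Proof.
have [R HR] := ramsey_cliques #|H| #|H|; exists R.+1 => /=.
apply/forallP=> c; have [|b [A [cA _ mA]]] := HR _ c setT.
  by rewrite cardsT card_ord.
have {}cA : #|H| = #|A| by rewrite cA; case: b {mA cA}.
apply/existsP; exists b; apply/existsP.
exists [ffun x : H => enum_val (cast_ord cA (enum_rank x))].
have injf : injective [ffun x : H => enum_val (cast_ord cA (enum_rank x))].
  by move=> x y; rewrite !ffunE => /enum_val_inj/cast_ord_inj/enum_rank_inj.
apply/andP; split; first exact/injectiveP.
apply/forallP=> x; apply/forallP=> y; apply/implyP=> xy; apply/eqP/mA.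
- by rewrite ffunE enum_valP.
- by rewrite ffunE enum_valP.
- by rewrite (inj_eq injf); apply: contraTneq xy => ->; rewrite sedge_irr.
Qed.

Definition ramsey_number (H : sgraph) : nat := ex_minn (ramsey_exists H).

(* Main.v *)
(** Dependent random choice, with a weighted count of the bad tuples.  Split
    K_N into halves P and Q; at least half of the vertices of P send half of
    their edges to Q in the same colour b, and X is the set of these.  For a
    random D-tuple T in Q, let A be the common b-neighbourhood of T in X.  Give
    a tuple S in A the weight 1/k if it has k < n common neighbours in Q, and
    0 otherwise; the tuples with k common neighbours lie in A with probability
    (k/|Q|)^D, which makes the expected total weight small compared with the
    expected size of A.  Then some A admits an injection f : H -> A for which
    the weights of the images of the neighbourhoods in H sum to at most 1.
    Processing the vertices v of H by increasing size of the common
    neighbourhood C v of f (N_H v), fewer than |C v| vertices precede v, so all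
    of them can be mapped greedily to distinct elements of the sets C v. *)

Require Import Defs.
From mathcomp Require Import all_boot.
From mathcomp Require Import all_order all_algebra lra zify.

Set Implicit Arguments.
Unset Strict Implicit.
Unset Printing Implicit Defensive.

Import Order.TTheory GRing.Theory Num.Theory.

(** * Greedy choice of distinct representatives *)

Lemma leq_expl m1 m2 k : m1 <= m2 -> m1 ^ k <= m2 ^ k.
Proof. by move=> le; elim: k => // k IHk; rewrite !expnS leq_mul. Qed.

(** Induct on the domain [U], placing last a [v] with the largest [C v]: all of [U] is then counted
    in the hypothesis at [v], so the fewer than [#|U|] values already used cannot cover [C v]. *)
Lemma greedy_sdr (I Q : finType) (q0 : Q) (C : I -> {set Q}) :
  (forall v, #|[set u | #|C u| <= #|C v|]| <= #|C v|) ->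
  exists2 g : I -> Q, injective g & forall v, g v \in C v.
Proof.
move=> hC.
suff main (m : nat) : forall U : {set I}, #|U| = m ->
    exists2 g : I -> Q, {in U &, injective g} & {in U, forall v, g v \in C v}.
  have [g injg gC] := main _ [set: I] erefl.
  by exists g => [x y|v]; [apply: injg | apply: gC]; rewrite ?inE.
elim: m => [|m IHm] U cU.
  have U0 := cards0_eq cU.
  by exists (fun=> q0) => [x y|x]; rewrite U0 inE.
have [v0 v0U] : exists v, v \in U by apply/set0Pn; rewrite -card_gt0 cU.
case: (arg_maxnP (fun v => #|C v|) v0U) => v vU0 vmax.
have vU : v \in U := vU0.
have [|g injg gC] := IHm (U :\ v).
  by move: cU; rewrite (cardsD1 v U) vU => -[].
have [q qC qg] : exists2 q, q \in C v & q \notin g @: (U :\ v).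
  apply/subsetPn; apply/negP => /subset_leq_card.
  rewrite leqNgt => /negP; apply.
  apply: (leq_ltn_trans (leq_imset_card _ _)).
  have -> : #|U :\ v|.+1 = #|U| by rewrite [RHS](cardsD1 v) vU.
  apply: leq_trans (hC v).
  by apply/subset_leq_card/subsetP=> u uU; rewrite inE; apply: vmax.
have gq u : u \in U -> u != v -> g u != q.
  move=> uU uv; apply: contraNneq qg => <-.
  by apply: imset_f; rewrite !inE uv.
exists (fun u => if u == v then q else g u) => [x y xU yU|x xU].
  case: (eqVneq x v) => [->|xv]; case: (eqVneq y v) => [->|yv] //.
  - by move=> e; case/eqP: (gq y yU yv).
  - by move=> e; case/eqP: (gq x xU xv).
  - by apply: injg; rewrite !inE ?xv ?yv.
by case: eqVneq => [->|xv] //; apply: gC; rewrite !inE xv.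
Qed.

(** * Counting injections with prescribed values *)

Section Injections.

Variables (I P : finType) (A : {set P}).

Definition injs := [set f : {ffun I -> P} | injectiveb f && [forall x, f x \in A]].

Lemma injsP (f : {ffun I -> P}) :
  reflect (injective f /\ forall x, f x \in A) (f \in injs).
Proof.
by rewrite inE; apply: (iffP andP) => -[/injectiveP ? /forallP ?].
Qed.

Lemma injs_neq0 : #|I| <= #|A| -> 0 < #|injs|.
Proof.
move=> le; apply/card_gt0P.
exists [ffun x : I => enum_val (widen_ord le (enum_rank x))].
apply/injsP; split=> [x y|x]; rewrite !ffunE ?enum_valP //.
by move=> /enum_val_inj/(congr1 val)/= /ord_inj/enum_rank_inj.
Qed.

(* Switching: if f agrees with s at x, then changing f x to any y in A outside
   the image of f gives another element of [injs], and (f, y) can be recovered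
   from it. *)
Lemma leq_injs_prescribed (s : {ffun I -> P}) (l : seq I) : uniq l ->
  (#|A| - #|I|) ^ size l * #|[set f in injs | all (fun x => f x == s x) l]|
    <= #|injs|.
Proof.
elim: l => [|x l IHl] /=.
  move=> _; rewrite expn0 mul1n; apply/subset_leq_card/subsetP=> f.
  by rewrite inE andbT.
case/andP=> xl ul; apply: leq_trans (IHl ul).
rewrite expnS -mulnA mulnCA leq_mul2l; apply/orP; right.
pose F := [set f in injs | (f x == s x) && all (fun z => f z == s z) l].
pose Z := [set fy : {ffun I -> P} * P |
             (fy.1 \in F) && (fy.2 \in A :\: fy.1 @: [set: I])].
pose phi (fy : {ffun I -> P} * P) : {ffun I -> P} :=
  [ffun z => if z == x then fy.2 else fy.1 z].
have FP f : f \in F -> [/\ f \in injs, f x = s x & all (fun z => f z == s z) l].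
  by rewrite [f \in F]inE => /andP[fI /andP[/eqP]].
have cZ : (#|A| - #|I|) * #|F| <= #|Z|.
  have -> : #|Z| = \sum_(f in F) \sum_(y in A :\: f @: [set: I]) 1.
    by rewrite pair_big_dep /= -sum1_card; apply: eq_bigl => fy; rewrite inE.
  rewrite mulnC -sum_nat_const; apply: leq_sum => f fF.
  rewrite sum1_card cardsD leq_sub2l //.
  apply: leq_trans (subset_leq_card (subsetIr _ _)) _.
  by rewrite (leq_trans (leq_imset_card _ _)) // cardsT.
apply: leq_trans cZ _.
rewrite -(card_in_imset (f := phi)); last first.
  move=> [f y] [f' y']; rewrite [(f, y) \in Z]inE [(f', y') \in Z]inE /=.
  case/andP=> /FP[_ fx _] _ /andP[/FP[_ fx' _] _].
  move=> /ffunP e; congr pair.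
    apply/ffunP=> z; have := e z; rewrite !ffunE /=.
    by case: eqVneq => [->|//]; rewrite fx fx'.
  by have := e x; rewrite !ffunE eqxx.
apply/subset_leq_card/subsetP=> h /imsetP[[f y] + ->{h}].
rewrite [_ \in Z]inE /= => /andP[/FP[/injsP[injf fA] _ /allP fl]].
rewrite in_setD => /andP[/negP ny yA].
rewrite [_ \in finset _]inE; apply/andP; split; last first.
  apply/allP=> z zl; rewrite ffunE /=; case: (eqVneq z x) => [zx|_]; last exact: fl.
  by rewrite -zx zl in xl.
have nfy z : f z <> y by move=> e; apply: ny; rewrite -e imset_f ?inE.
apply/injsP; split=> [z z'|z]; rewrite !ffunE /=.
  case: (eqVneq z x) => [->|_]; case: (eqVneq z' x) => [->|_] //.
  - by move/esym/nfy.
  - by move/nfy.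
  - exact: injf.
by case: eqVneq.
Qed.

(** If some injection [s] restricts to [S], restricting to [S] means agreeing with [s] along
    [enum K]; otherwise the count is zero. *)
Lemma leq_injs_restriction (K : pred I) (S : {ffun {x | K x} -> P}) :
  (#|A| - #|I|) ^ #|{: {x | K x}}| *
    #|[set f in injs | [ffun k => f (val k)] == S]| <= #|injs|.
Proof.
case: (set_0Vmem [set f in injs | [ffun k => f (val k)] == S]) => [->|[s]].
  by rewrite cards0 muln0.
rewrite inE => /andP[_ /eqP/ffunP sS].
apply: leq_trans (leq_injs_prescribed s (enum_uniq K)).
rewrite card_sig -cardE leq_mul2l; apply/orP; right.
apply/subset_leq_card/subsetP=> f; rewrite !inE => /andP[-> /eqP/ffunP fS] /=.
apply/allP=> x; rewrite mem_enum => Kx.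
by have := fS (exist _ x Kx); rewrite -sS !ffunE /= => ->.
Qed.

End Injections.

Local Open Scope ring_scope.

(** * Averaging, and defects of small sets *)

Lemma sum_lt_exists (I : finType) (B : pred I) (F G : I -> rat) :
  \sum_(i | B i) F i < \sum_(i | B i) G i -> exists2 i, B i & F i < G i.
Proof.
move=> lt; case: (boolP [exists (i | B i), F i < G i]) => [/exists_inP //|].
rewrite negb_exists_in => /forall_inP h.
have : \sum_(i | B i) G i <= \sum_(i | B i) F i.
  by apply: ler_sum => i /h; rewrite -leNgt.
by rewrite leNgt lt.
Qed.

(** As the inverse of 0 is 0, an empty set gets defect 0, so nonemptiness has to be secured
    separately. *)
Definition defect (n m : nat) : rat := if (m < n)%N then m%:R^-1 else 0.

Lemma defect_ge0 n m : 0 <= defect n m.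
Proof. by rewrite /defect; case: ifP => // _; rewrite invr_ge0 ler0n. Qed.

(** If [#|C v| < #|I|], each [u] with [#|C u| <= #|C v|] has defect at least [1 / #|C v|] (all sets
    being nonempty), so a total of at most 1 allows at most [#|C v|] such [u]. *)
Lemma sdr_of_defect (I Q : finType) (q0 : Q) (C : I -> {set Q}) :
  (forall v, 0 < #|C v|)%N -> \sum_v defect #|I| #|C v| <= 1 ->
  exists2 g : I -> Q, injective g & forall v, g v \in C v.
Proof.
move=> C0 le1; apply: (greedy_sdr q0) => v.
have [leI|ltI] := leqP #|I| #|C v|; first exact: leq_trans (max_card _) leI.
rewrite -(ler_nat rat) -[leRHS]mul1r -ler_pdivrMr ?ltr0n //.
apply: le_trans le1.
rewrite (bigID (fun u => #|C u| <= #|C v|)%N) /=.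
rewrite -[leLHS]addr0; apply: lerD; last first.
  by apply: sumr_ge0 => u _; apply: defect_ge0.
rewrite -sum1dep_card natr_sum mulr_suml.
apply: ler_sum => u leu; rewrite /defect (leq_ltn_trans leu ltI) mul1r.
by rewrite lef_pV2 ?posrE ?ltr0n // ler_nat.
Qed.

Definition tuples (K R : finType) (A : {set R}) : {set {ffun K -> R}} :=
  [set S : {ffun K -> R} | [forall k, S k \in A]].

Lemma card_tuples (K R : finType) (A : {set R}) :
  #|tuples K A| = (#|A| ^ #|K|)%N.
Proof.
rewrite -card_ffun_on; apply: eq_card => S; rewrite inE.
by apply/forallP/ffun_onP.
Qed.

(** * Dependent random choice *)

Section DependentRandomChoice.

Variables (V P Q : finType) (E : rel V) (e : P -> Q -> bool) (X : {set P}).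
Variable D : nat.

Hypothesis D_gt0 : (0 < D)%N.
Hypothesis degD : forall v, (#|{: {x | E x v}}| <= D)%N.
Hypothesis V_gt0 : (0 < #|V|)%N.
Hypothesis leXQ : (#|X| <= #|Q|)%N.
Hypothesis ltX : (2 ^ (D + 2) * #|V| < #|X|)%N.
Hypothesis degX : forall x, x \in X -> (#|Q| <= 2 * #|[set q | e x q]|)%N.

Let n := #|V|.
Let M := #|Q|.

Let leVQ : (n <= M)%N.
Proof.
by apply: leq_trans leXQ; apply: leq_trans (ltnW ltX); rewrite leq_pmull ?expn_gt0.
Qed.

Let M_gt0 : (0 < M)%N. Proof. exact: leq_trans leVQ. Qed.

Definition common (K : finType) (S : {ffun K -> P}) : {set Q} :=
  [set q | [forall k, e (S k) q]].

Definition cnbh (T : {ffun 'I_D -> Q}) : {set P} :=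
  [set x in X | [forall i, e x (T i)]].

Lemma in_cnbh x T : (x \in cnbh T) = (x \in X) && [forall i, e x (T i)].
Proof. by rewrite inE. Qed.

Lemma sum_card_cnbh : (#|X| * M ^ D <= 2 ^ D * \sum_T #|cnbh T|)%N.
Proof.
have -> : (\sum_T #|cnbh T| = \sum_(x in X) #|[set q | e x q]| ^ D)%N.
  under eq_bigr do rewrite -sum1_card.
  rewrite (exchange_big_dep (fun x => x \in X)) /=; last first.
    by move=> T x _; rewrite in_cnbh => /andP[].
  apply: eq_bigr => x xX; rewrite sum1dep_card -[D in RHS]card_ord -card_tuples.
  apply: eq_card => T; rewrite [LHS]inE [RHS]inE in_cnbh xX /=.
  by apply: eq_forallb => i; rewrite inE.
rewrite big_distrr /= -sum_nat_const; apply: leq_sum => x xX.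
by rewrite -expnMn leq_exp2r // degX.
Qed.

Definition weight (T : {ffun 'I_D -> Q}) (v : V) : rat :=
  \sum_(S in tuples {x | E x v} (cnbh T)) defect n #|common S|.

Lemma weight_ge0 T v : 0 <= weight T v.
Proof. by apply: sumr_ge0 => S _; apply: defect_ge0. Qed.

(** A tuple [S] in [X] with [m] common neighbours lies in [cnbh T] for exactly [m ^ D] tuples [T];
    if [m < n] it contributes at most [m ^ (D - 1)]. There are at most [M ^ d] such [S], and
    [n ^ D * M ^ d <= M ^ D * n ^ d] since [d <= D] and [n <= M]. *)
Lemma sum_weight v :
  n%:R * \sum_T weight T v <= M%:R ^+ D * n%:R ^+ #|{: {x | E x v}}|.
Proof.
pose K : finType := {x | E x v}; rewrite -[#|_|]/#|K|; set d := #|K|.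
have -> : \sum_T weight T v = \sum_(S in tuples K X)
    (#|common S| ^ D)%:R * defect n #|common S|.
  rewrite (exchange_big_dep (fun S => S \in tuples K X)) /=; last first.
    move=> T S _; rewrite !inE => /forallP h; apply/forallP=> k.
    by have := h k; rewrite in_cnbh => /andP[].
  apply: eq_bigr => S; rewrite inE => /forallP SX.
  rewrite [RHS]mulr_natl -[D in RHS]card_ord -card_tuples -sumr_const.
  apply: eq_bigl => T; rewrite !inE.
  apply/forallP/forallP => [h i|h k].
    rewrite inE; apply/forallP=> k; have := h k.
    by rewrite in_cnbh => /andP[_ /forallP].
  rewrite in_cnbh SX /=; apply/forallP=> i; have := h i.
  by rewrite inE => /forallP.
rewrite mulr_sumr; apply: (@le_trans _ _ (\sum_(S in tuples K X) n%:R ^+ D)).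
  apply: ler_sum => S _; set m := #|common S|; rewrite /defect.
  case: ltnP => lt; last by rewrite !mulr0 exprn_ge0.
  rewrite -(prednK D_gt0) expnSr natrM -mulrA.
  have [->|m0] := posnP m; first by rewrite mul0r !mulr0 exprn_ge0.
  rewrite divff ?pnatr_eq0 -?lt0n // mulr1 -natrX -natrM ler_nat expnS.
  by rewrite leq_mul2l leq_expl ?orbT // ltnW.
rewrite sumr_const card_tuples -/d -[leLHS]mulr_natl -!natrX -!natrM ler_nat.
have dD : (d <= D)%N by apply: degD.
rewrite -(subnK dD) !expnD mulnA leq_mul2r (mulnC (M ^ _)%N).
by rewrite leq_mul ?orbT ?leq_expl.
Qed.

(** This normalisation makes vertices of all degrees comparable: each contributes at most [1 / n] on
    average over [T], so the mean load is at most 1. *)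
Definition load T := \sum_v weight T v / n%:R ^+ #|{: {x | E x v}}|.

Let n0 : (0 : rat) < n%:R. Proof. by rewrite ltr0n. Qed.

Lemma load_ge0 T : 0 <= load T.
Proof.
by apply: sumr_ge0 => v _; rewrite divr_ge0 ?weight_ge0 ?exprn_ge0 ?ler0n.
Qed.

Lemma sum_load : \sum_T load T <= M%:R ^+ D.
Proof.
rewrite exchange_big /=.
apply: (@le_trans _ _ (\sum_(v : V) M%:R ^+ D / n%:R)).
  apply: ler_sum => v _; rewrite -mulr_suml.
  rewrite ler_pdivrMr ?exprn_gt0 // mulrAC ler_pdivlMr // mulrC.
  exact: sum_weight.
by rewrite sumr_const -[leLHS]mulr_natl mulrCA divff ?mulr1 // gt_eqF.
Qed.

(** The left side averages at most [4n] over [T], while [#|cnbh T|] averages at least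
    [#|X| / 2 ^ D > 4n]. *)
Lemma exists_light_tuple :
  exists T, 2 * n%:R + 2 * n%:R * load T < #|cnbh T|%:R.
Proof.
have [|T _ ltT] := @sum_lt_exists {ffun 'I_D -> Q} xpredT
    (fun T => 2 * n%:R + 2 * n%:R * load T) (fun T => #|cnbh T|%:R);
  last by exists T.
rewrite big_split /= sumr_const -mulr_sumr card_ffun card_ord.
rewrite -natr_sum.
apply: (@le_lt_trans _ _ (4 * n%:R * (M ^ D)%:R)).
  have := sum_load; rewrite -natrX -mulr_natl => le.
  have := ler_wpM2l (ltW n0) le; rewrite -/M; lra.
have Mp : (0 < M ^ D)%N by rewrite expn_gt0 M_gt0.
rewrite -!natrM ltr_nat -(ltn_pmul2l (expn_gt0 2 D)).
apply: leq_trans sum_card_cnbh.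
by rewrite !mulnA ltn_pmul2r // -(expnD 2 D 2).
Qed.

(** Group the injections by their restriction to the neighbours of [v] and bound each group by
    [leq_injs_restriction]. *)
Lemma sum_injs_defect T v :
  ((#|cnbh T| - n) ^ #|{: {x | E x v}}|)%:R *
  \sum_(f in injs V (cnbh T))
     defect n #|common [ffun k : {x | E x v} => f (val k)]|
  <= #|injs V (cnbh T)|%:R * weight T v.
Proof.
pose K : finType := {x | E x v}.
rewrite (partition_big (fun f : {ffun V -> P} => [ffun k : K => f (val k)])
           (mem (tuples K (cnbh T)))) /=; last first.
  move=> f /injsP[_ fA]; rewrite inE; apply/forallP=> k.
  by rewrite ffunE.
rewrite /weight !mulr_sumr; apply: ler_sum => S _.
rewrite (eq_bigr (fun=> defect n #|common S|)); last by move=> f /andP[_ /eqP ->].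
rewrite sumr_const mulrnAr -mulrnAl -mulrnA ler_wpM2r ?defect_ge0 // ler_nat.
have := leq_injs_restriction (cnbh T) S.
rewrite (eq_card (B := fun f : {ffun V -> P} => (f \in injs V (cnbh T)) &&
  ([ffun k : K => f (val k)] == S))) // => f.
by rewrite [_ \in finset _]inE.
Qed.

Lemma exists_light_injection T :
  2 * n%:R + 2 * n%:R * load T < #|cnbh T|%:R ->
  exists2 f, f \in injs V (cnbh T) &
    \sum_v defect n #|common [ffun k : {x | E x v} => f (val k)]| <= 1.
Proof.
move=> ltA; set a := #|cnbh T|; set b := (a - n)%N.
have u0 := load_ge0 T; set u := load T in ltA u0.
have nu0 := mulr_ge0 (ltW n0) u0.
have le2na : (2 * n <= a)%N by rewrite -(ler_nat rat) natrM; lra.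
have lena : (n <= a)%N by rewrite (leq_trans _ le2na) // leq_pmull.
have leb : n%:R * (1 + u) <= b%:R :> rat.
  by rewrite natrB //; move: le2na; rewrite -(ler_nat rat) natrM; lra.
have b0 : (0 : rat) < b%:R.
  by apply: lt_le_trans leb; rewrite mulr_gt0 //; lra.
have I0 : (0 : rat) < #|injs V (cnbh T)|%:R by rewrite ltr0n injs_neq0.
have bound v : \sum_(f in injs V (cnbh T))
     defect n #|common [ffun k : {x | E x v} => f (val k)]|
   <= #|injs V (cnbh T)|%:R * (weight T v / n%:R ^+ #|{: {x | E x v}}| / (1 + u)).
  set d := #|{: {x | E x v}}|.
  (* Without neighbours no factor [1 + u] can be gained, but then the common neighbourhood is all of
     [Q], of defect 0 as [n <= M]. *)
  have [d0|d_gt0] := posnP d.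
    rewrite big1 => [|f _].
      rewrite mulr_ge0 ?ler0n //; apply: divr_ge0; last by lra.
      by rewrite divr_ge0 ?weight_ge0 ?exprn_ge0 ?ler0n.
    have -> : common [ffun k : {x | E x v} => f (val k)] = [set: Q].
      apply/setP=> q; rewrite !inE; apply/forallP=> k.
      by have /card0_eq/(_ k) := d0; rewrite inE.
    by rewrite /defect cardsT ltnNge leVQ.
  have bd0 : (0 : rat) < b%:R ^+ d by rewrite exprn_gt0.
  apply: (@le_trans _ _ (#|injs V (cnbh T)|%:R * (weight T v / b%:R ^+ d))).
    rewrite mulrA ler_pdivlMr // mulrC -natrX; exact: sum_injs_defect.
  rewrite ler_wpM2l ?ler0n // -mulrA ler_wpM2l ?weight_ge0 //.
  have u1 : 0 < 1 + u by lra.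
  rewrite -invfM lef_pV2 ?posrE ?mulr_gt0 ?exprn_gt0 //.
  (* For [d > 0], [(1 + u) ^ d] is at least [1 + u]; this factor brings the mean total defect down
     to [u / (1 + u) < 1]. *)
  apply: (@le_trans _ _ ((n%:R * (1 + u)) ^+ d)); last first.
    by rewrite lerXn2r ?nnegrE // mulr_ge0 // ltW.
  rewrite exprMn ler_wpM2l ?exprn_ge0 ?ler0n //.
  by rewrite -[leLHS]expr1 ler_weXn2l //; lra.
have [|f fI lt] := @sum_lt_exists _ (fun f => f \in injs V (cnbh T))
    (fun f => \sum_v defect n #|common [ffun k : {x | E x v} => f (val k)]|)
    (fun=> 1).
  rewrite exchange_big /= sumr_const.
  apply: (@le_lt_trans _ _ (#|injs V (cnbh T)|%:R * (u / (1 + u)))).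
    by rewrite /u /load mulr_suml mulr_sumr; apply: ler_sum => v _; apply: bound.
  rewrite gtr_pMr // ltr_pdivrMr; lra.
by exists f => //; apply: ltW.
Qed.

(** Both maps are defined on all of [V]; a bipartition later selects [f] on one side and [g] on the
    other. *)
Lemma bipartite_embedding : exists f : V -> P, exists g : V -> Q,
  [/\ injective f, injective g & forall x y, E x y -> e (f x) (g y)].
Proof.
have [T /exists_light_injection[f /injsP[injf fA] le1]] := exists_light_tuple.
have [|g injg gC] := sdr_of_defect (T (Ordinal D_gt0)) _ le1.
  (* Any entry of [T] is adjacent to all of [cnbh T], hence lies in every common neighbourhood. *)
  move=> v; apply/card_gt0P; exists (T (Ordinal D_gt0)); rewrite inE.
  apply/forallP=> k; rewrite ffunE; have := fA (val k).
  by rewrite inE => /andP[_ /forallP].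
exists f, g; split=> // x y xy; have := gC y.
by rewrite inE => /forallP/(_ (exist _ x xy)); rewrite ffunE.
Qed.

End DependentRandomChoice.

Local Close Scope ring_scope.

(** * From colourings of the complete graph to the bipartite embedding *)

Lemma majority_color (P Q : finType) (col : P -> Q -> bool) : exists b : bool,
  #|P| <= 2 * #|[set x | #|Q| <= 2 * #|[set q | col x q == b]|]|.
Proof.
pose Z b := [set x | #|Q| <= 2 * #|[set q | col x q == b]|].
have covZ : #|P| <= #|Z true| + #|Z false|.
  rewrite -cardsT; apply: leq_trans (leq_card_setU _ _).
  apply/subset_leq_card/subsetP=> x _; rewrite !inE.
  rewrite -[_ || _]negbK negb_or -!ltnNge; apply/negP=> /andP[lt1 lt2].
  have : #|Q| <= #|[set q | col x q == true]| + #|[set q | col x q == false]|.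
    rewrite -cardsT; apply: leq_trans (leq_card_setU _ _).
    by apply/subset_leq_card/subsetP=> q _; rewrite !inE; case: (col x q).
  rewrite leqNgt => /negP; apply.
  lia.
have [le|lt] := leqP #|Z false| #|Z true|.
  by exists true; apply: leq_trans covZ _; rewrite mul2n -addnn leq_add2l.
by exists false; apply: leq_trans covZ _; rewrite mul2n -addnn leq_add2r ltnW.
Qed.

Lemma arrows_bipartite (H : sgraph) (M D : nat) :
  0 < D -> 0 < #|H| -> bipartite H -> (forall x : H, degree x <= D) ->
  2 ^ (D + 3) * #|H| < M -> arrows (M + M) H.
Proof.
move=> D0 H0 [A bipA] degD ltM; apply/forallP=> c.
pose col (x y : 'I_M) := c [set lshift M x; rshift M y].
have [b leX] := majority_color col; apply/existsP; exists b.
have [|||||f [g [injf injg fg]]] :=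
    @bipartite_embedding H 'I_M 'I_M (@sedge H) (fun x y => col x y == b)
      [set x | #|'I_M| <= 2 * #|[set q | col x q == b]|] D D0.
- move=> v; rewrite card_sig; apply: leq_trans (degD v).
  by rewrite subset_leq_card //; apply/subsetP=> x; rewrite !inE sedge_sym.
- exact: H0.
- exact: max_card.
(* The majority set has at least [M / 2] elements, which turns [D + 3] into [D + 2]. *)
- rewrite -(ltn_pmul2l (isT : 0 < 2)).
  apply: leq_trans leX; rewrite card_ord mulnA -expnS -addnS; exact: ltM.
- by move=> x; rewrite inE.
apply/existsP.
exists [ffun z => if z \in A then lshift M (f z) else rshift M (g z)].
apply/andP; split.
  apply/injectiveP=> x y; rewrite !ffunE.
  case: ifP => _; case: ifP => _; last by move/rshift_inj/injg.
  - by move/lshift_inj/injf.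
  - by move/eqP; rewrite eq_lrshift.
  - by move/eqP; rewrite eq_rlshift.
apply/forallP=> x; apply/forallP=> y; apply/implyP=> xy; rewrite !ffunE.
have := bipA _ _ xy; case: ifP => _; case: ifP => _ // _.
  exact: fg.
by rewrite setUC; apply: fg; rewrite sedge_sym.
Qed.

Theorem theorem4p1 (H : sgraph) (n Delta : nat) (Hn0 : 0 < n)
  (Hn : #|H| = n) (Hbip : bipartite H) (HDelta : max_degree H = Delta) :
  ramsey_number H <= 2 ^ (Delta + 6) * n.
Proof.
rewrite /ramsey_number; case: ex_minnP => m _; apply.
rewrite muln_gt0 expn_gt0 Hn0 /=.
have -> : 2 ^ (Delta + 6) * n = 2 ^ (Delta + 5) * n + 2 ^ (Delta + 5) * n.
  by rewrite addnS expnS -mulnA mul2n addnn.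
(* The random tuple must be nonempty, also when [Delta = 0]. *)
apply: (@arrows_bipartite H _ Delta.+1); rewrite ?Hn //.
  by move=> x; rewrite -HDelta leqW // (leq_bigmax x).
(* With [D = Delta + 1], [D + 3] is [Delta + 4], one less than the exponent in the size of each
   half. *)
by rewrite ltn_pmul2r // ltn_exp2l // addSnnS ltn_add2l.
Qed.
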